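(* Let $\mathscr{A}=(a_{ijkl})\in\mathbb{T}_{4,3}$ be a paired symmetric tensor, and let $\mathscr{T}_A^1,\mathscr{T}_B^1\in\mathbb{T}_{4,3}$ and $\mathscr{T}_A^2,\mathscr{T}_B^2\in\mathbb{T}_{6,3}$ be the unique symmetric tensors such that, for all $x,y\in\mathbb{R}^3$, $$\mathscr{T}_A^1y^4=(y^\top A_{11}y)(y^\top A_{22}y)-(y^\top A_{12}y)(y^\top A_{21}y),\qquad \mathscr{T}_A^2y^6=\det(A(y)),$$ $$\mathscr{T}_B^1x^4=(x^\top B_{11}x)(x^\top B_{22}x)-(x^\top B_{12}x)(x^\top B_{21}x),\qquad \mathscr{T}_B^2x^6=\det(B(x)).$$ Then the polynomial $\mathscr{A}x^2y^2$ is positive definite if and only if one of the following holds: (i) the symmetric matrix $A_{11}$ is positive definite, and the smallest $Z$-eigenvalues of $\mathscr{T}_A^1$ and $\mathscr{T}_A^2$ are positive; (ii) the symmetric matrix $B_{11}$ is positive definite, and the smallest $Z$-eigenvalues of $\mathscr{T}_B^1$ and $\mathscr{T}_B^2$ are positive. Furthermore, if $\mathscr{A}$ is an elasticity tensor, then conditions (i) and (ii) are the same.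
   Context: $\mathbb{T}_{m,3}$ is the set of real tensors $(t_{i_1\cdots i_m})$ with all indices in $\{1,2,3\}$; a tensor is symmetric if its entries are invariant under all permutations of indices. For $\mathscr{T}\in\mathbb{T}_{m,3}$ and $y\in\mathbb{R}^3$, $\mathscr{T}y^m:=\sum t_{i_1\cdots i_m}y_{i_1}\cdots y_{i_m}$ and $(\mathscr{T}y^{m-1})_i:=\sum_{i_2,\ldots,i_m} t_{ii_2\cdots i_m}y_{i_2}\cdots y_{i_m}$. A $Z$-eigenvalue of a symmetric $\mathscr{T}$ is a real $\lambda$ for which there is $y\in\mathbb{R}^3$ with $\mathscr{T}y^{m-1}=\lambda y$, $y^\top y=1$. A tensor $\mathscr{A}=(a_{ijkl})\in\mathbb{T}_{4,3}$ is paired symmetric if $a_{ijkl}=a_{jikl}=a_{ijlk}=a_{jilk}$ for all indices; it is an elasticity tensor if moreover $a_{ijkl}=a_{klij}$ for all indices. For $x,y\in\mathbb{R}^3$, $\mathscr{A}x^2y^2:=\sum_{i,j,k,l=1}^3a_{ijkl}x_ix_jy_ky_l$; this polynomial is positive definite if $\mathscr{A}x^2y^2>0$ for all $x,y\in\mathbb{R}^3\setminus\{0\}$. For $i,j\in\{1,2,3\}$, $A_{ij}\in\mathbb{R}^{3\times3}$ is the matrix whose $(k,l)$ entry is $a_{ijkl}$; for $k,l\in\{1,2,3\}$, $B_{kl}\in\mathbb{R}^{3\times 3}$ is the matrix whose $(i,j)$ entry is $a_{ijkl}$. $A(y)\in\mathbb{R}^{3\times3}$ has $(i,j)$ entry $y^\top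 A_{ij}y$, and $B(x)\in\mathbb{R}^{3\times 3}$ has $(k,l)$ entry $x^\top B_{kl}x$. *)

(* Defs.v *)
From mathcomp Require Import all_boot all_order all_fingroup all_algebra.
From mathcomp Require Import reals.

Set Implicit Arguments.
Unset Strict Implicit.
Unset Printing Implicit Defensive.

Import Order.TTheory GRing.Theory Num.Theory.
Local Open Scope ring_scope.

(* Indices are 0-based: the mathematical index i in {1, .., n} is the element
   i - 1 of 'I_n. *)
Definition tensor (R : realType) (m n : nat) := {ffun m.-tuple 'I_n -> R}.

Definition symmetric_tensor (R : realType) (m n : nat) (T : tensor R m n) :=
  forall (s : 'S_m) (t : m.-tuple 'I_n), T [tuple tnth t (s j) | j < m] = T t.

(* T y^m *)
Definition tensor_form (R : realType) (m n : nat) (T : tensor R m n)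
    (y : 'cV[R]_n) : R :=
  \sum_(t : m.-tuple 'I_n) T t * \prod_(j < m) y (tnth t j) 0.

(* T y^(m-1), for a tensor T whose order m is written m'.+1 *)
Definition tensor_contract (R : realType) (m' n : nat) (T : tensor R m'.+1 n)
    (y : 'cV[R]_n) : 'cV[R]_n :=
  \col_i \sum_(t : m'.-tuple 'I_n)
     T [tuple of i :: t] * \prod_(j < m') y (tnth t j) 0.

Definition Zeigenvalue (R : realType) (m' n : nat) (T : tensor R m'.+1 n)
    (lambda : R) : Prop :=
  exists y : 'cV[R]_n, tensor_contract T y = lambda *: y /\ y^T *m y = 1%:M.

Definition smallest_Zeigenvalue (R : realType) (m' n : nat)
    (T : tensor R m'.+1 n) (lambda : R) : Prop :=
  Zeigenvalue T lambda /\ forall mu, Zeigenvalue T mu -> lambda <= mu.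

Definition smallest_Zeigenvalue_positive (R : realType) (m' n : nat)
    (T : tensor R m'.+1 n) : Prop :=
  exists lambda : R, smallest_Zeigenvalue T lambda /\ 0 < lambda.

(* x^T M x *)
Definition quad_form (R : realType) (n : nat) (M : 'M[R]_n) (x : 'cV[R]_n) : R :=
  (x^T *m M *m x) 0 0.

Definition posdef_mx (R : realType) (n : nat) (M : 'M[R]_n) : Prop :=
  M^T = M /\ forall x : 'cV[R]_n, x != 0 -> 0 < quad_form M x.

Definition entry (R : realType) (A : tensor R 4 3) (i j k l : 'I_3) : R :=
  A [tuple i; j; k; l].

Definition paired_symmetric (R : realType) (A : tensor R 4 3) : Prop :=
  forall i j k l : 'I_3,
    [/\ entry A i j k l = entry A j i k l,
        entry A i j k l = entry A i j l k
      & entry A i j k l = entry A j i l k].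

Definition elasticity_tensor (R : realType) (A : tensor R 4 3) : Prop :=
  paired_symmetric A /\
  forall i j k l : 'I_3, entry A i j k l = entry A k l i j.

(* A x^2 y^2 *)
Definition biquadratic (R : realType) (A : tensor R 4 3) (x y : 'cV[R]_3) : R :=
  \sum_(i < 3) \sum_(j < 3) \sum_(k < 3) \sum_(l < 3)
     entry A i j k l * x i 0 * x j 0 * y k 0 * y l 0.

Definition biquadratic_posdef (R : realType) (A : tensor R 4 3) : Prop :=
  forall x y : 'cV[R]_3, x != 0 -> y != 0 -> 0 < biquadratic A x y.

Definition Ablock (R : realType) (A : tensor R 4 3) (i j : 'I_3) : 'M[R]_3 :=
  \matrix_(k, l) entry A i j k l.

Definition Bblock (R : realType) (A : tensor R 4 3) (k l : 'I_3) : 'M[R]_3 :=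
  \matrix_(i, j) entry A i j k l.

(* A(y) *)
Definition Amx (R : realType) (A : tensor R 4 3) (y : 'cV[R]_3) : 'M[R]_3 :=
  \matrix_(i, j) quad_form (Ablock A i j) y.

(* B(x) *)
Definition Bmx (R : realType) (A : tensor R 4 3) (x : 'cV[R]_3) : 'M[R]_3 :=
  \matrix_(k, l) quad_form (Bblock A k l) x.

(* Positivity of the leading principal minors of A(y) (or B(x)): M is the
   (1,1) block, T1 and T2 represent the minors of order 2 and 3. *)
Definition minors_condition (R : realType) (M : 'M[R]_3)
    (T1 : tensor R 4 3) (T2 : tensor R 6 3) : Prop :=
  [/\ posdef_mx M,
      smallest_Zeigenvalue_positive T1
    & smallest_Zeigenvalue_positive T2].

(* Main.v *)
(* A x^2 y^2 is the quadratic form of the symmetric matrix A(y) at x, and also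
   that of B(x) at y, so it is positive definite iff the three leading principal
   minors of A(y) are positive for every y <> 0 (Sylvester), and likewise for
   B(x). These minors are forms of even degree in y, and the smallest
   Z-eigenvalue of a symmetric tensor of even order is the minimum of its form
   on the unit sphere: a minimum exists by compactness and is a Z-eigenvalue by
   Lagrange multipliers, while T y^m = lambda at every unit Z-eigenvector y. *)

Require Import Defs.
From mathcomp Require Import all_boot all_order all_fingroup all_algebra.
From mathcomp Require Import reals.
From mathcomp Require Import boolp classical_sets topology normedtype derive.
From mathcomp Require Import ring lra.

Import Order.TTheory GRing.Theory Num.Theory.
Import numFieldNormedType.Exports.
Local Open Scope ring_scope.

Set Implicit Arguments.
Unset Strict Implicit.
Unset Printing Implicit Defensive.

(** * Slices of a tensor and recursion on the order *)

Definition slice (R : realType) (m n : nat) (T : tensor R m.+1 n) (i : 'I_n) :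
    tensor R m n :=
  [ffun t : m.-tuple 'I_n => T [tuple of i :: t]].

Lemma tensor_contractE (R : realType) (m n : nat) (T : tensor R m.+1 n)
    (y : 'cV[R]_n) (i : 'I_n) :
  tensor_contract T y i 0 = tensor_form (slice T i) y.
Proof. by rewrite mxE; apply: eq_bigr => t _; rewrite ffunE. Qed.

Lemma tensor_formS (R : realType) (m n : nat) (T : tensor R m.+1 n)
    (y : 'cV[R]_n) :
  tensor_form T y = \sum_i y i 0 * tensor_form (slice T i) y.
Proof.
under [RHS]eq_bigr => i _ do rewrite big_distrr /=.
rewrite pair_bigA /=.
rewrite [LHS](reindex (fun p : 'I_n * m.-tuple 'I_n => [tuple of p.1 :: p.2])) /=.
  apply: eq_bigr => -[i t] _ /=; rewrite ffunE big_ord_recl tnth0 mulrCA.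
  by congr (_ * (_ * _)); apply: eq_bigr => j _; rewrite tnthS.
exists (fun t : m.+1.-tuple 'I_n => (thead t, [tuple of behead t])).
  by move=> [i t] _ /=; congr pair; apply: val_inj.
by move=> t _ /=; rewrite -tuple_eta.
Qed.

Lemma tensor_form_order0 (R : realType) (n : nat) (T : tensor R 0 n)
    (y : 'cV[R]_n) : tensor_form T y = T [tuple].
Proof.
rewrite /tensor_form (big_pred1 [tuple]) ?big_ord0 ?mulr1 // => t /=.
by rewrite tuple0; apply/esym/eqP.
Qed.

Lemma slice_symmetric (R : realType) (m n : nat) (T : tensor R m.+1 n)
    (i : 'I_n) : symmetric_tensor T -> symmetric_tensor (slice T i).
Proof.
(* Extend [s] to a permutation of all the indices that fixes the first one. *)
move=> symT s t; rewrite !ffunE -[RHS](symT (lift_perm ord0 ord0 s)).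
congr (T _); apply: eq_from_tnth => j; rewrite tnth_mktuple.
case: (unliftP ord0 j) => [k|] ->.
  by rewrite lift_perm_lift !tnthS tnth_mktuple.
by rewrite lift_perm_id !tnth0.
Qed.

Lemma slice_swap (R : realType) (m n : nat) (T : tensor R m.+2 n) (i j : 'I_n) :
  symmetric_tensor T -> slice (slice T i) j = slice (slice T j) i.
Proof.
move=> symT; apply/ffunP => t; rewrite !ffunE.
rewrite -[RHS](symT (tperm ord0 (lift ord0 ord0))).
congr (T _); apply: eq_from_tnth => k; rewrite tnth_mktuple.
case: (unliftP ord0 k) => [l|] ->; last by rewrite tpermL tnthS !tnth0.
case: (unliftP ord0 l) => [l'|] ->; last by rewrite tpermR tnthS !tnth0.
by rewrite tpermD ?(inj_eq lift_inj) ?neq_lift // !tnthS.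
Qed.

Lemma tensor_formZ (R : realType) (m n : nat) (T : tensor R m n) (c : R)
    (y : 'cV[R]_n) : tensor_form T (c *: y) = c ^+ m * tensor_form T y.
Proof.
rewrite /tensor_form big_distrr /=; apply: eq_bigr => t _.
under eq_bigr => j _ do rewrite mxE.
by rewrite big_split /= prodr_const card_ord mulrCA.
Qed.

(** On a line the form is a polynomial in [s], so directional derivatives can be taken formally. The
    product rule gives one term per index position, and symmetry makes these terms equal. *)
Lemma tensor_form_line (R : realType) (m n : nat) (T : tensor R m.+1 n)
    (y h : 'cV[R]_n) : symmetric_tensor T ->
  exists2 p : {poly R}, forall s, p.[s] = tensor_form T (y + s *: h)
    & p^`().[0] = m.+1%:R * \sum_i h i 0 * tensor_form (slice T i) y.
Proof.
elim: m T => [|m IHm] T symT.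
  exists (\sum_i ((y i 0)%:P + (h i 0) *: 'X) * (slice T i [tuple])%:P).
    move=> s; rewrite tensor_formS horner_sum; apply: eq_bigr => i _.
    by rewrite tensor_form_order0 !hornerE !mxE; ring.
  rewrite mul1r linear_sum horner_sum; apply: eq_bigr => i _ /=.
  rewrite tensor_form_order0 derivM derivD derivZ derivX !derivC.
  by rewrite !hornerE /=.
have /fin_all_exists[p p_prop] i : exists p : {poly R},
    (forall s, p.[s] = tensor_form (slice T i) (y + s *: h)) /\
    p^`().[0] = m.+1%:R * \sum_j h j 0 * tensor_form (slice (slice T i) j) y.
  by have [p] := IHm _ (@slice_symmetric _ _ _ T i symT); exists p.
exists (\sum_i ((y i 0)%:P + (h i 0) *: 'X) * p i).
  move=> s; rewrite tensor_formS horner_sum; apply: eq_bigr => i _.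
  by rewrite !hornerE (p_prop i).1 !mxE; ring.
rewrite linear_sum horner_sum /=.
under eq_bigr => i _ do rewrite derivM derivD derivZ derivX !derivC !hornerE
  (p_prop i).1 (p_prop i).2 scale0r addr0.
(* One copy comes from differentiating the outer coordinate, the other [m.+1] from the slices by
   induction. *)
rewrite big_split /= -[X in _ = X%:R * _]add1n natrD mulrDl mul1r; congr (_ + _).
under eq_bigr => i _ do rewrite mulrCA big_distrr /=.
rewrite -big_distrr /= exchange_big /=; congr (_ * _).
(* Swapping the two slicing indices turns the inner sum into the form of [slice T j]. *)
apply: eq_bigr => j _; rewrite [in RHS]tensor_formS big_distrr /=.
by apply: eq_bigr => i _; rewrite mulrCA (slice_swap _ _ symT).
Qed.

(* Differentiating the form in the direction of the i-th basis vector recovers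
   the form of the i-th slice, which allows induction on the order. *)
Lemma symmetric_tensor_form_inj (R : realType) (m n : nat) (T U : tensor R m n) :
    symmetric_tensor T -> symmetric_tensor U ->
  (forall y, tensor_form T y = tensor_form U y) -> T = U.
Proof.
elim: m T U => [|m IHm] T U symT symU eqTU.
  apply/ffunP => t; rewrite tuple0.
  by have := eqTU 0; rewrite !tensor_form_order0.
have eq_slice i : slice T i = slice U i.
  apply: IHm => [||y]; try exact: slice_symmetric.
  have [p pE dp] := tensor_form_line y (delta_mx i 0) symT.
  have [q qE dq] := tensor_form_line y (delta_mx i 0) symU.
  have sum_delta (V : tensor R m.+1 n) :
      \sum_j (delta_mx i 0 : 'cV[R]_n) j 0 * tensor_form (slice V j) y
      = tensor_form (slice V i) y.
    rewrite (bigD1 i) //= mxE !eqxx mul1r big1 ?addr0 // => j /negPf ji.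
    by rewrite mxE ji mul0r.
  (* [p - q] vanishes at [size (p - q)] distinct naturals, too many for a nonzero polynomial of that
     size. *)
  have eq_pq : p = q.
    apply/eqP; rewrite -subr_eq0; apply/eqP/(@roots_geq_poly_eq0 _ _
      [seq k%:R | k <- iota 0 (size (p - q))]).
    - by apply/allP => s _; rewrite /root !hornerE pE qE eqTU subrr.
    - rewrite map_inj_uniq ?iota_uniq // => a b /eqP.
      by rewrite eqr_nat => /eqP.
    - by rewrite size_map size_iota.
  move: dp; rewrite eq_pq dq !sum_delta => /mulfI -> //.
  by rewrite pnatr_eq0.
apply/ffunP => t; rewrite (tuple_eta t).
by have /ffunP/(_ [tuple of behead t]) := eq_slice (thead t); rewrite !ffunE.
Qed.

(** * Z-eigenvalues and the minimum on the unit sphere *)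

Definition sqnorm (R : realType) (n : nat) (y : 'cV[R]_n) : R :=
  \sum_i y i 0 ^+ 2.

Lemma sqnorm_ge0 (R : realType) (n : nat) (y : 'cV[R]_n) : 0 <= sqnorm y.
Proof. by apply: sumr_ge0 => i _; exact: sqr_ge0. Qed.

Lemma sqnorm_gt0 (R : realType) (n : nat) (y : 'cV[R]_n) :
  (0 < sqnorm y) = (y != 0).
Proof.
rewrite lt_def sqnorm_ge0 andbT; congr (~~ _).
rewrite /sqnorm psumr_eq0 => [|i _]; last exact: sqr_ge0.
apply/allP/eqP => [y0|-> i _]; last by rewrite mxE expr0n eqxx.
apply/colP => i; rewrite mxE; apply/eqP.
by have := y0 i (mem_index_enum i); rewrite /= sqrf_eq0.
Qed.

Lemma sqnormZ (R : realType) (n : nat) (c : R) (y : 'cV[R]_n) :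
  sqnorm (c *: y) = c ^+ 2 * sqnorm y.
Proof.
by rewrite /sqnorm big_distrr; apply: eq_bigr => i _; rewrite mxE exprMn.
Qed.

Lemma trmul_colE (R : realType) (n : nat) (y : 'cV[R]_n) :
  y^T *m y = (sqnorm y)%:M.
Proof.
rewrite [LHS]mx11_scalar !mxE; congr (_%:M).
by apply: eq_bigr => i _; rewrite mxE expr2.
Qed.

(** Pair the eigenvector equation with [y]. *)
Lemma Zeigenvalue_tensor_form (R : realType) (m n : nat)
    (T : tensor R m.+1 n) (lambda : R) (y : 'cV[R]_n) :
    tensor_contract T y = lambda *: y -> sqnorm y = 1 ->
  tensor_form T y = lambda.
Proof.
move=> Ty y1; rewrite tensor_formS -[RHS]mulr1 -y1 big_distrr.
apply: eq_bigr => i _ /=.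
by rewrite -tensor_contractE Ty mxE expr2 mulrCA.
Qed.

Lemma trmx_coord_continuous (R : realType) (n : nat) (i : 'I_n) :
  continuous (fun u : 'rV[R]_n => u^T i 0).
Proof.
under [X in continuous X]eq_fun => u do rewrite mxE.
exact: coord_continuous.
Qed.

(** The compactness argument runs over row vectors, hence the transpose. *)
Lemma continuous_tensor_form_row (R : realType) (m n : nat) (T : tensor R m n) :
  continuous (fun u : 'rV[R]_n => tensor_form T u^T).
Proof.
elim: m T => [|m IHm] T.
  under [X in continuous X]eq_fun => u do rewrite tensor_form_order0.
  exact: cst_continuous.
under [X in continuous X]eq_fun => u do rewrite tensor_formS.
apply: continuous_big => [|i _]; first exact: add_continuous.
by move=> u; apply: (@cvgM _ _ (nbhs u)); [exact: trmx_coord_continuous | exact: IHm].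
Qed.

Lemma tensor_form_min (R : realType) (m n : nat) (T : tensor R m n.+1) :
  exists2 y : 'cV[R]_n.+1, sqnorm y = 1 &
    forall z, sqnorm z = 1 -> tensor_form T y <= tensor_form T z.
Proof.
pose S := [set u : 'rV[R]_n.+1 | sqnorm u^T = 1]%classic.
have S0 : (S !=set0)%classic.
  exists (delta_mx 0 0); rewrite /S /= /sqnorm (bigD1 0) //= !mxE !eqxx expr1n.
  by rewrite big1 ?addr0 // => i /negPf i0; rewrite !mxE i0 andbF expr0n.
have compactS : compact S.
  apply: bounded_closed_compact.
    exists 1; split => // M M1 u Su; apply: le_trans (ltW M1).
    (* The norm is the largest absolute value of a coordinate, and each squared coordinate is a
       summand of [sqnorm u^T = 1]. *)
    rewrite [leLHS]/Num.Def.normr /= mx_normrE; apply/bigmax_leP; split => // -[i j] _ /=.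
    rewrite -(@ler_pXn2r _ 2) ?nnegrE // expr1n -normrX ger0_norm ?sqr_ge0 //.
    rewrite -[leRHS]Su /sqnorm (bigD1 j) //= mxE ord1 lerDl.
    by apply: sumr_ge0 => k _; exact: sqr_ge0.
  apply: (@preimage_closed _ _ (fun u : 'rV[R]_n.+1 => sqnorm u^T) [set 1]%classic).
    move=> u _; rewrite /sqnorm; apply: continuous_big; first exact: add_continuous.
    by move=> i _ v; apply: (@cvgM _ _ (nbhs v)); exact: trmx_coord_continuous.
  exact: closed_eq.
have [u uS umin] := compact_EVT_min S0 compactS
  (continuous_subspaceT (@continuous_tensor_form_row _ _ _ T)).
exists u^T; first by move: uS; rewrite inE.
by move=> z z1; rewrite -[z]trmxK; apply: umin; rewrite inE /S /= trmxK.
Qed.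

(** Transfers the analytic first-order condition at an interior minimum to the formal derivative;
    the interval from -1 to 1 is just a neighbourhood of 0. *)
Lemma horner_min_deriv (R : realType) (p : {poly R}) :
  (forall s, p.[0] <= p.[s]) -> p^`().[0] = 0.
Proof.
move=> pmin; have dp := is_derive_poly p 0.
have dp0 : is_derive (0 : R) 1 (horner p) 0.
  apply: (@derive1_at_min _ _ (-1) 1).
  - lra.
  - by move=> t _; exact: derivable_horner.
  - by rewrite in_itv /=; apply/andP; split; lra.
  - by move=> t _; exact: pmin.
by rewrite -(@derive_val _ _ _ _ _ _ _ dp) (@derive_val _ _ _ _ _ _ _ dp0).
Qed.

Lemma normalize_col (R : realType) (n : nat) (y : 'cV[R]_n) : y != 0 ->
  exists c u, [/\ 0 < c, sqnorm u = 1, c ^+ 2 = sqnorm y & y = c *: u].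
Proof.
rewrite -sqnorm_gt0 => y0; pose c := Num.sqrt (sqnorm y).
have c0 : 0 < c by rewrite sqrtr_gt0.
have c2 : c ^+ 2 = sqnorm y by rewrite sqr_sqrtr ?sqnorm_ge0.
exists c, (c^-1 *: y); split => //; last by rewrite scalerA divff ?scale1r ?gt_eqF.
by rewrite sqnormZ -c2 exprVn mulVf // expf_neq0 ?gt_eqF.
Qed.

(* Lagrange multipliers without constraint: by homogeneity the minimum [lambda]
   on the sphere makes [T z^m - lambda |z|^m] nonnegative everywhere, with a
   zero at [y], so that its derivative at [y] vanishes in every direction. *)
Lemma tensor_form_min_eigen (R : realType) (m k n : nat) (T : tensor R m.+1 n)
    (y : 'cV[R]_n) : m.+1 = k.*2 -> symmetric_tensor T -> sqnorm y = 1 ->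
    (forall z, sqnorm z = 1 -> tensor_form T y <= tensor_form T z) ->
  tensor_contract T y = tensor_form T y *: y.
Proof.
move=> mk symT y1 ymin; set lambda := tensor_form T y in ymin *.
have form_ge z : lambda * sqnorm z ^+ k <= tensor_form T z.
  have [->|/normalize_col[c [u [c0 u1 c2 ->]]]] := eqVneq z 0.
    (* At [z = 0] both sides vanish: [mk] excludes [k = 0], where [0 ^+ k] would be 1. *)
    rewrite -[0](scale0r y) tensor_formZ sqnormZ expr0n mul0r expr0n /=.
    by move: mk; case: k => [|k] //=; rewrite expr0n /= mulr0 mul0r.
  (* Both sides scale by [c ^+ m.+1 = (c ^+ 2) ^+ k], which reduces the claim to the unit vector
     [u]. *)
  rewrite tensor_formZ [X in c ^+ X]mk -muln2 mulnC exprM sqnormZ u1 mulr1 mulrC.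
  by rewrite ler_pM2l ?exprn_gt0 //; exact: ymin.
apply/colP => i; pose h : 'cV[R]_n := delta_mx i 0.
have [p pE dp] := tensor_form_line y h symT.
(* The squared norm along the line, so that the gap [p - lambda *: N ^+ k] is a nonnegative
   polynomial vanishing at 0. *)
pose N : {poly R} := \sum_j ((y j 0)%:P + (h j 0) *: 'X) ^+ 2.
have NE s : N.[s] = sqnorm (y + s *: h).
  by rewrite horner_sum; apply: eq_bigr => j _; rewrite !hornerE !mxE; ring.
have sum_h (F : 'I_n -> R) : \sum_j h j 0 * F j = F i.
  rewrite (bigD1 i) //= mxE !eqxx mul1r big1 ?addr0 // => j /negPf ji.
  by rewrite mxE ji mul0r.
have dN : N^`().[0] = 2 * y i 0.
  rewrite linear_sum horner_sum /= -[RHS](sum_h (fun j => 2 * y j 0)).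
  apply: eq_bigr => j _; rewrite deriv_exp derivD derivZ derivX !derivC !hornerE.
  by rewrite /=; ring.
have : (p - lambda *: N ^+ k)^`().[0] = 0.
  apply: horner_min_deriv => s.
  rewrite !hornerE !NE !pE scale0r addr0 y1 expr1n mulr1 subrr subr_ge0.
  exact: form_ge.
rewrite derivB derivZ deriv_exp !hornerE hornerMn hornerM horner_exp.
rewrite NE scale0r addr0 y1 expr1n mulr1 dN dp sum_h -tensor_contractE => /eqP.
rewrite (_ : _ - _ = m.+1%:R * (tensor_contract T y i 0 - lambda * y i 0)).
  by rewrite mulf_eq0 pnatr_eq0 /= subr_eq0 => /eqP ->; rewrite mxE.
(* Differentiating [N ^+ k] gives [k * 2 * y i 0], and [2 * k] is the order [m.+1], the factor in
   [dp]. *)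
rewrite -[_ *+ k]mulr_natl (_ : m.+1%:R = k%:R * 2) ?mk -?muln2 ?natrM //.
by ring.
Qed.

(** The minimum on the sphere is a Z-eigenvalue and a lower bound for all of them; homogeneity
    carries positivity from the sphere to every nonzero vector. *)
Lemma smallest_Zeigenvalue_positiveP (R : realType) (m k n : nat)
    (T : tensor R m.+1 n.+1) : m.+1 = k.*2 -> symmetric_tensor T ->
  smallest_Zeigenvalue_positive T <->
  forall y : 'cV[R]_n.+1, y != 0 -> 0 < tensor_form T y.
Proof.
move=> mk symT; have [y y1 ymin] := tensor_form_min T.
have eig_y : Zeigenvalue T (tensor_form T y).
  exists y; split; first exact: (tensor_form_min_eigen mk).
  by rewrite trmul_colE y1.
split=> [[lambda [[_ lambda_min] lambda0]] z|T0].
  move=> /normalize_col[c [u [c0 u1 _ ->]]].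
  rewrite tensor_formZ mulr_gt0 ?exprn_gt0 //.
  apply: lt_le_trans lambda0 (le_trans _ (ymin u u1)).
  exact: lambda_min.
exists (tensor_form T y); split; last by rewrite T0 // -sqnorm_gt0 y1.
split=> // mu [z [Tz]]; rewrite trmul_colE => /(congr1 (fun M : 'M_1 => M 0 0)).
rewrite !mxE !mulr1n => z1; rewrite -(Zeigenvalue_tensor_form Tz z1).
exact: ymin.
Qed.

(** * Quadratic forms and Sylvester's criterion in dimension 3 *)

Lemma quad_formE (R : realType) (n : nat) (M : 'M[R]_n) (x : 'cV[R]_n) :
  quad_form M x = \sum_i \sum_j M i j * x i 0 * x j 0.
Proof.
rewrite /quad_form !mxE; under eq_bigr => j _ do rewrite mxE big_distrl /=.
rewrite exchange_big /=; apply: eq_bigr => i _; apply: eq_bigr => j _.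
by rewrite !mxE [_ * M i j]mulrC.
Qed.

Lemma big_ord3 (V : nmodType) (F : 'I_3 -> V) : \sum_i F i = F 0 + F 1 + F 2.
Proof.
rewrite !big_ord_recl big_ord0 addr0 addrA.
by congr (_ + F _ + F _); apply: val_inj.
Qed.

Lemma det_mx33 (R : comNzRingType) (M : 'M[R]_3) :
  \det M = M 0 0 * (M 1 1 * M 2 2 - M 1 2 * M 2 1)
         - M 0 1 * (M 1 0 * M 2 2 - M 1 2 * M 2 0)
         + M 0 2 * (M 1 0 * M 2 1 - M 1 1 * M 2 0).
Proof.
rewrite (expand_det_row _ 0) big_ord3 /cofactor.
do ![rewrite (expand_det_row _ 0) !big_ord_recl big_ord0 /cofactor !det_mx11 !mxE /=].
have l00 : lift (0 : 'I_3) 0 = 1 by apply: val_inj.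
have l01 : lift (0 : 'I_3) (lift 0 0) = 2 by apply: val_inj.
have l10 : lift (1 : 'I_3) 0 = 0 by apply: val_inj.
have l11 : lift (1 : 'I_3) (lift 0 0) = 2 by apply: val_inj.
have l20 : lift (2 : 'I_3) 0 = 0 by apply: val_inj.
have l21 : lift (2 : 'I_3) (lift 0 0) = 1 by apply: val_inj.
have l000 : lift (lift (0 : 'I_2) 0) (0 : 'I_1) = 0 by apply: val_inj.
rewrite l000 l00 l01 l10 l11 l20 l21 /bump /=.
ring.
Qed.

(** Explicit identities suffice: each minor appears in the value of the form at a test vector, and
    conversely the form is, up to a positive factor, a weighted sum of squares. *)
Lemma posdef_minors3 (R : realType) (M : 'M[R]_3) : M^T = M ->
  (forall x : 'cV[R]_3, x != 0 -> 0 < quad_form M x) <->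
  [/\ 0 < M 0 0, 0 < M 0 0 * M 1 1 - M 0 1 * M 1 0 & 0 < \det M].
Proof.
move=> symM.
have symME i j : M i j = M j i by rewrite -[in LHS]symM mxE.
have quadE (x : 'cV[R]_3) : quad_form M x =
    M 0 0 * x 0 0 ^+ 2 + M 1 1 * x 1 0 ^+ 2 + M 2 2 * x 2 0 ^+ 2
    + 2 * (M 0 1 * (x 0 0 * x 1 0) + M 0 2 * (x 0 0 * x 2 0)
           + M 1 2 * (x 1 0 * x 2 0)).
  rewrite quad_formE !big_ord3 (symME 1 0) (symME 2 0) (symME 2 1); ring.
have detE : \det M = M 0 0 * (M 1 1 * M 2 2 - M 1 2 * M 1 2)
         - M 0 1 * (M 0 1 * M 2 2 - M 1 2 * M 0 2)
         + M 0 2 * (M 0 1 * M 1 2 - M 1 1 * M 0 2).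
  by rewrite det_mx33 (symME 1 0) (symME 2 0) (symME 2 1).
rewrite detE (symME 1 0).
move: (M 0 0) (M 0 1) (M 0 2) (M 1 1) (M 1 2) (M 2 2) {symME detE} quadE
  => a b c d e f quadE.
pose v (p q r : R) : 'cV[R]_3 := \col_i nth 0 [:: p; q; r] i.
have quadv p q r : quad_form M (v p q r) =
    a * p ^+ 2 + d * q ^+ 2 + f * r ^+ 2 + 2 * (b * (p * q) + c * (p * r) + e * (q * r)).
  by rewrite quadE !mxE.
have v_neq0 p q r : [|| p != 0, q != 0 | r != 0] -> v p q r != 0.
  apply: contraTneq => /colP v0.
  by have := (v0 0, v0 1, v0 2); rewrite !mxE /= => -[[-> ->] ->]; rewrite eqxx.
split=> [pos|[a0 D0 det0] x x0].
  have a0 : 0 < a.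
    have := pos (v 1 0 0); rewrite quadv v_neq0 ?oner_neq0 // => /(_ isT).
    by rewrite (_ : _ + _ = a) //; ring.
  have D0 : 0 < a * d - b * b.
    (* The last column of the adjugate of the leading 2 by 2 block. *)
    have := pos (v (- b) a 0); rewrite quadv ?v_neq0 ?(gt_eqF a0) ?orbT // => /(_ isT).
    by rewrite (_ : _ + _ = a * (a * d - b * b)) ?pmulr_rgt0 //; ring.
  split=> //.
  (* the test vector is the last column of the adjugate matrix *)
  have := pos (v (b * e - c * d) (b * c - a * e) (a * d - b * b)).
  rewrite quadv ?v_neq0 ?(gt_eqF D0) ?orbT // => /(_ isT).
  set q := (X in 0 < X -> _); set delta := (X in _ -> 0 < X).
  by rewrite (_ : q = (a * d - b * b) * delta) ?pmulr_rgt0 // /q /delta; ring.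
rewrite -(pmulr_rgt0 _ (mulr_gt0 a0 D0)) quadE.
set p := x 0 0; set q := x 1 0; set r := x 2 0.
set delta := (X in 0 < X) in det0.
(* completing the square twice, with denominators cleared *)
have -> : a * (a * d - b * b) * (a * p ^+ 2 + d * q ^+ 2 + f * r ^+ 2 +
       2 * (b * (p * q) + c * (p * r) + e * (q * r)))
  = (a * d - b * b) * (a * p + b * q + c * r) ^+ 2
    + ((a * d - b * b) * q + (a * e - b * c) * r) ^+ 2 + a * delta * r ^+ 2.
  by rewrite /delta; ring.
have sq_gt0 (z : R) : z != 0 -> 0 < z ^+ 2.
  by move=> z0; rewrite lt_def sqr_ge0 sqrf_eq0 z0.
have D1 := sqr_ge0 (a * p + b * q + c * r).
have D2 := sqr_ge0 ((a * d - b * b) * q + (a * e - b * c) * r).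
(* The last nonzero coordinate of [x] decides which of the three squares is strictly positive. *)
have [r0|r0] := eqVneq r 0; last first.
  apply: ltr_wpDl; first by rewrite addr_ge0 // mulr_ge0 // ltW.
  exact: mulr_gt0 (mulr_gt0 a0 det0) (sq_gt0 _ r0).
have [q0|q0] := eqVneq q 0; last first.
  rewrite r0 !mulr0 !addr0 expr0n /= mulr0 addr0.
  apply: ltr_wpDl; first by rewrite mulr_ge0 ?sqr_ge0 // ltW.
  by apply: sq_gt0; rewrite mulf_neq0 // (gt_eqF D0).
rewrite r0 q0 !mulr0 !addr0 expr0n /= mulr0 !addr0.
apply: mulr_gt0 => //; apply: sq_gt0; rewrite mulf_neq0 ?(gt_eqF a0) //.
apply: contraNneq x0 => p0; apply/eqP/colP => i; rewrite mxE.
case: i => -[|[|[|//]]] lt_i; [rewrite -[RHS]p0 | rewrite -[RHS]q0 | rewrite -[RHS]r0].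
all: by congr (x _ _); apply: val_inj.
Qed.

(** * The biquadratic form and the two matrix families *)

Lemma biquadraticE (R : realType) (A : tensor R 4 3) (x y : 'cV[R]_3) :
  biquadratic A x y = quad_form (Amx A y) x.
Proof.
rewrite quad_formE; apply: eq_bigr => i _; apply: eq_bigr => j _.
rewrite mxE quad_formE -mulrA big_distrl; apply: eq_bigr => k _ /=.
rewrite big_distrl; apply: eq_bigr => l _ /=.
by rewrite mxE; ring.
Qed.

Lemma biquadraticC (R : realType) (A : tensor R 4 3) (x y : 'cV[R]_3) :
  biquadratic A x y = quad_form (Bmx A x) y.
Proof.
rewrite biquadraticE !quad_formE.
(* Grouping the indices as pairs [(i, j)] and [(k, l)] leaves a single exchange of sums. *)
under eq_bigr => i _ do under eq_bigr => j _ do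
  rewrite mxE quad_formE pair_bigA -mulrA big_distrl /=.
under [RHS]eq_bigr => k _ do under eq_bigr => l _ do
  rewrite mxE quad_formE pair_bigA -mulrA big_distrl /=.
rewrite [LHS]pair_bigA [RHS]pair_bigA [LHS]exchange_big /=.
apply: eq_bigr => -[k l] _; apply: eq_bigr => -[i j] _ /=.
by rewrite !mxE; ring.
Qed.

(** The family [N] is abstract so as to cover both [Amx A] and [Bmx A]. Sylvester's criterion is
    applied at each fixed [y], and the values 2 and 3 of [k] are half the orders of [T1] and
    [T2]. *)
Lemma posdef_minors_condition (R : realType) (M : 'M[R]_3)
    (T1 : tensor R 4 3) (T2 : tensor R 6 3) (N : 'cV[R]_3 -> 'M[R]_3) :
    symmetric_tensor T1 -> symmetric_tensor T2 -> M^T = M ->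
    (forall y, (N y)^T = N y) -> (forall y, N y 0 0 = quad_form M y) ->
    (forall y, tensor_form T1 y = N y 0 0 * N y 1 1 - N y 0 1 * N y 1 0) ->
    (forall y, tensor_form T2 y = \det (N y)) ->
  (forall x y : 'cV[R]_3, x != 0 -> y != 0 -> 0 < quad_form (N y) x) <->
  minors_condition M T1 T2.
Proof.
move=> symT1 symT2 symM symN NE T1E T2E; split=> [pos|].
  have minors y : y != 0 -> _ := fun y0 =>
    (posdef_minors3 (symN y)).1 (fun x x0 => pos x y x0 y0).
  split.
  - by split=> // y /minors[]; rewrite NE.
  - apply/(smallest_Zeigenvalue_positiveP (k := 2)) => // y /minors[_].
    by rewrite T1E.
  - apply/(smallest_Zeigenvalue_positiveP (k := 3)) => // y /minors[_ _].
    by rewrite T2E.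
case=> -[_ M0] /(smallest_Zeigenvalue_positiveP (k := 2)) T10
  /(smallest_Zeigenvalue_positiveP (k := 3)) T20 x y x0 y0.
apply: (posdef_minors3 (symN y)).2 x x0.
by rewrite -T1E -T2E NE; split; [exact: M0 | exact: T10 | exact: T20].
Qed.

Theorem theorem4p3 (R : realType) (A : tensor R 4 3)
    (TA1 TB1 : tensor R 4 3) (TA2 TB2 : tensor R 6 3)
    (hA : paired_symmetric A)
    (symTA1 : symmetric_tensor TA1) (symTA2 : symmetric_tensor TA2)
    (symTB1 : symmetric_tensor TB1) (symTB2 : symmetric_tensor TB2)
    (hTA1 : forall y : 'cV[R]_3,
       tensor_form TA1 y =
         quad_form (Ablock A 0 0) y * quad_form (Ablock A 1 1) y
         - quad_form (Ablock A 0 1) y * quad_form (Ablock A 1 0) y)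
    (hTA2 : forall y : 'cV[R]_3, tensor_form TA2 y = \det (Amx A y))
    (hTB1 : forall x : 'cV[R]_3,
       tensor_form TB1 x =
         quad_form (Bblock A 0 0) x * quad_form (Bblock A 1 1) x
         - quad_form (Bblock A 0 1) x * quad_form (Bblock A 1 0) x)
    (hTB2 : forall x : 'cV[R]_3, tensor_form TB2 x = \det (Bmx A x)) :
  (biquadratic_posdef A <->
     minors_condition (Ablock A 0 0) TA1 TA2 \/
     minors_condition (Bblock A 0 0) TB1 TB2)
  /\
  (elasticity_tensor A ->
     [/\ Ablock A 0 0 = Bblock A 0 0, TA1 = TB1, TA2 = TB2
       & (minors_condition (Ablock A 0 0) TA1 TA2 <->
          minors_condition (Bblock A 0 0) TB1 TB2)]).
Proof.
have symA y : (Amx A y)^T = Amx A y.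
  apply/matrixP => i j; rewrite !mxE; congr (quad_form _ y).
  by apply/matrixP => k l; rewrite !mxE; case: (hA i j k l).
have symB x : (Bmx A x)^T = Bmx A x.
  apply/matrixP => k l; rewrite !mxE; congr (quad_form _ x).
  by apply/matrixP => i j; rewrite !mxE; case: (hA i j k l).
have symA00 : (Ablock A 0 0)^T = Ablock A 0 0.
  by apply/matrixP => k l; rewrite !mxE; case: (hA 0 0 k l).
have symB00 : (Bblock A 0 0)^T = Bblock A 0 0.
  by apply/matrixP => i j; rewrite !mxE; case: (hA i j 0 0).
(* Each of (i) and (ii) is by itself equivalent to positive definiteness, so the disjunction follows
   propositionally. *)
have condA : biquadratic_posdef A <-> minors_condition (Ablock A 0 0) TA1 TA2.
  rewrite -(posdef_minors_condition symTA1 symTA2 symA00 symA) //.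
  - by split=> pos x y x0 y0; have := pos x y x0 y0; rewrite biquadraticE.
  - by move=> y; rewrite mxE.
  - by move=> y; rewrite hTA1 !mxE.
have condB : biquadratic_posdef A <-> minors_condition (Bblock A 0 0) TB1 TB2.
  rewrite -(posdef_minors_condition symTB1 symTB2 symB00 symB) //.
  - by split=> pos x y x0 y0; have := pos y x y0 x0; rewrite biquadraticC.
  - by move=> x; rewrite mxE.
  - by move=> x; rewrite hTB1 !mxE.
split; first by tauto.
(* The symmetry [eA] identifies the blocks, hence the forms, and a symmetric tensor is determined by
   its form. *)
case=> _ eA; have eqAB i j : Ablock A i j = Bblock A i j.
  by apply/matrixP => k l; rewrite !mxE eA.
split; last by tauto.
- exact: eqAB.
- by apply: symmetric_tensor_form_inj => // y; rewrite hTA1 hTB1 !eqAB.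
- apply: symmetric_tensor_form_inj => // y; rewrite hTA2 hTB2.
  by congr (\det _); apply/matrixP => i j; rewrite !mxE eqAB.
Qed.
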